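(* $NPO(5)=16$.
   Context: All graphs are finite, simple and undirected; $A(G)$ denotes the adjacency matrix of $G$. Eigenvalues are counted with multiplicity. For a positive integer $k$, $NPO(k)$ is the smallest integer $n$ such that the adjacency matrix of every graph with at least $n$ vertices has at least $k$ nonpositive eigenvalues. *)

(* Defs.v *)
From HB Require Import structures.
From mathcomp Require Import all_boot all_order all_algebra all_field.
Set Implicit Arguments. Unset Strict Implicit. Unset Printing Implicit Defensive.
Import Order.TTheory GRing.Theory Num.Theory.
Local Open Scope ring_scope.

Definition simple_graph (n : nat) (e : rel 'I_n) : Prop :=
  (forall x y, e x y = e y x) /\ (forall x, ~~ e x x).

Definition adj_mx (n : nat) (e : rel 'I_n) : 'M[algC]_n :=
  \matrix_(i, j) (e i j)%:R.

Definition eigenvalue_list (n : nat) (A : 'M[algC]_n) (rs : seq algC) : Prop :=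
  char_poly A = \prod_(r <- rs) ('X - r%:P).

Definition at_least_nonpos_eigs (k n : nat) (A : 'M[algC]_n) : Prop :=
  exists rs, eigenvalue_list A rs /\ (k <= count (fun r : algC => (r <= 0)%R) rs)%N.

Definition NPO_bound (k n : nat) : Prop :=
  forall (m : nat) (e : rel 'I_m), (n <= m)%N -> simple_graph e ->
    at_least_nonpos_eigs k (adj_mx e).

Definition NPO_is (k N : nat) : Prop :=
  NPO_bound k N /\ forall n, NPO_bound k n -> (N <= n)%N.

(* Main.v *)
Require Import Defs.
From HB Require Import structures.
From mathcomp Require Import all_boot all_order all_algebra all_field.
From Stdlib Require Import FMapPositive.
From mathcomp Require Import zify ring.
Set Implicit Arguments. Unset Strict Implicit. Unset Printing Implicit Defensive.
Import Order.TTheory GRing.Theory Num.Theory.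
Local Open Scope ring_scope.

(** If a graph with adjacency matrix A has at most four nonpositive eigenvalues,
there are no five independent, pairwise A-orthogonal vectors of nonpositive
A-norm.  So once four such vectors are fixed, every vector that is A-orthogonal
to them and independent of them has positive norm; integer vectors supported on
few vertices then turn into constraints on edges.
- If four vertices are independent, the outside vertices have distinct nonempty
  traces on them, and x + y = z + w between traces (with the empty trace allowed)
  forces a_xy + a_zw > a_xz + a_xw + a_yz + a_yw: at most one of six literals
  fails.  Unit propagation shows that 12 of the 15 traces cannot all occur.
- If the independence number is 3, the outside vertices are grouped by their trace
  on an independent triple.  Differences of vertices with equal trace bound the
  size of each group, and the groups contain at most 12 vertices in total.
- Otherwise, with 16 vertices, Ramsey's bound R(3,5) <= 15 gives a K5, and the
  Schur complement of the K5 is positive definite.  A vertex with w neighbours in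
  K5 has norm w(4 - w), so w is 1, 2 or 3; those with w = 2 are orthogonal, and
  the others form an obtuse system of at most 3 vectors, each of which leaves room
  for at most 2 vertices with w = 2.  So at most 10 vertices are outside.
The last case is attained: K5 joined to the Petersen graph by incidence has 15
vertices and 11 positive eigenvalues. *)

Local Notation "M ^t*" := (map_mx Num.conj (trmx M)) (at level 30) : ring_scope.

(** * Inertia of hermitian matrices *)

Lemma char_poly_similar (n : nat) (P A : 'M[algC]_n) :
  P \in unitmx -> char_poly (invmx P *m A *m P) = char_poly A.
Proof.
move=> Pu; rewrite /char_poly.
have -> : char_poly_mx (invmx P *m A *m P) =
    map_mx polyC (invmx P) *m char_poly_mx A *m map_mx polyC P.
  rewrite /char_poly_mx mulmxBr mulmxBl -!map_mxM; congr (_ - _).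
  by rewrite mul_mx_scalar -scalemxAl -map_mxM mulVmx // map_mx1 scalemx1.
by rewrite !det_mulmx mulrAC -det_mulmx -map_mxM mulVmx // map_mx1 det1 mul1r.
Qed.

(** The columns picked by [t] form a lower triangular matrix with nonzero diagonal; its right
    inverse, spread over those columns, is a right inverse of [W]. *)
Lemma triangular_row_free (F : fieldType) (k m : nat) (W : 'M[F]_(k, m))
    (t : 'I_k -> 'I_m) :
  (forall i, W i (t i) != 0) -> (forall i j : 'I_k, (i < j)%N -> W i (t j) = 0) ->
  row_free W.
Proof.
move=> W1 W0; suff: row_free (colsub t W).
  case/row_freeP=> B; rewrite -[W in colsub t W]mulmx1 -mulmx_colsub -mulmxA => WB.
  by apply/row_freeP; exists (colsub t 1%:M *m B).
rewrite row_free_unit unitmxE det_trig; last first.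
  by apply/is_trig_mxP=> i j ij; rewrite mxE W0.
by rewrite unitfE; apply/prodf_neq0 => i _; rewrite mxE.
Qed.

(** Fewer than [k] linear conditions on [k] coefficients. This is the dimension count behind both
    inertia inequalities below. *)
Lemma exists_vanishing_row (F : fieldType) (k m : nat) (Y : 'M[F]_(k, m))
    (J : {pred 'I_m}) : (#|J| < k)%N ->
  exists2 c : 'rV[F]_k, c != 0 & forall j, j \in J -> (c *m Y) 0 j = 0.
Proof.
move=> Jk; pose Z := colsub (fun i : 'I_#|J| => enum_val i) Y.
have : kermx Z != 0.
  rewrite kermx_eq0 -row_leq_rank -ltnNge.
  exact: leq_ltn_trans (rank_leq_col _) Jk.
case/rowV0Pn=> c /sub_kermxP cZ c0; exists c => // j jJ.
have := congr1 (fun M : 'rV_#|J| => M 0 (enum_rank_in jJ j)) cZ.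
by rewrite /Z mulmx_colsub !mxE enum_rankK_in.
Qed.

Section Inertia.
Variables (m : nat) (A : 'M[algC]_m).
Hypothesis Aherm : A \is hermsymmx.

Let P := spectralmx A.
Let d := spectral_diag A.

Let AE : A = invmx P *m diag_mx d *m P.
Proof. by apply/orthomx_spectralP/hermitian_normalmx. Qed.

Let PVE : invmx P = P ^t*.
Proof. exact/invmx_unitary/spectral_unitarymx. Qed.

Lemma spectral_diag_real i : d 0 i \is Num.real.
Proof. by have /mxOverP := hermitian_spectral_diag_real Aherm; apply. Qed.

Lemma spectral_eigenvalue_list : eigenvalue_list A [seq d 0 i | i <- enum 'I_m].
Proof.
rewrite /eigenvalue_list {1}AE char_poly_similar ?spectral_unit //.
rewrite char_poly_trig ?diag_mx_is_trig // big_map big_enum /=.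
by apply: eq_bigr => i _; rewrite mxE eqxx mulr1n.
Qed.

Lemma eigenvalue_list_count (p : pred algC) rs :
  eigenvalue_list A rs -> count p rs = #|[pred i | p (d 0 i)]|.
Proof.
rewrite /eigenvalue_list spectral_eigenvalue_list => /prod_XsubC_eq.
move=> /permP/(_ p) <-; rewrite count_map -sum1_count.
by rewrite big_enum_cond /= sum1_card.
Qed.

Lemma spectral_form (v : 'rV[algC]_m) :
  (v *m A *m v ^t*) 0 0 = \sum_i d 0 i * `|(v *m P ^t*) 0 i| ^+ 2.
Proof.
have -> : v *m A *m v ^t* = (v *m P ^t*) *m diag_mx d *m (v *m P ^t*) ^t*.
  rewrite trmx_mul map_mxM /= {1}AE PVE !mulmxA; congr (_ *m _ *m _).
  by apply/matrixP=> i j; rewrite !mxE conjCK.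
rewrite mxE; apply: eq_bigr => i _; rewrite mul_mx_diag !mxE normCK.
by rewrite mulrAC mulrC.
Qed.

Lemma gram_form k (W : 'M[algC]_(k, m)) (g : 'rV_k) (c : 'rV_k) :
  W *m A *m W ^t* = diag_mx g ->
  ((c *m W) *m A *m (c *m W) ^t*) 0 0 = \sum_i g 0 i * `|c 0 i| ^+ 2.
Proof.
move=> Wg; have -> : (c *m W) *m A *m (c *m W) ^t* = c *m diag_mx g *m c ^t*.
  by rewrite -Wg trmx_mul map_mxM /= !mulmxA.
rewrite mxE; apply: eq_bigr => i _; rewrite mul_mx_diag !mxE normCK.
by rewrite mulrAC mulrC.
Qed.

Let vP_eq0 (v : 'rV[algC]_m) : v *m P ^t* = 0 -> v = 0.
Proof.
move=> v0; rewrite -[v]mulmx1 -(@mulVmx _ _ P) ?spectral_unit //.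
by rewrite PVE mulmxA v0 mul0mx.
Qed.

(** If too few eigenvalues were nonpositive, a nonzero combination of the rows would avoid all their
    eigenvectors. Its norm would be a sum of nonnegative terms and yet nonpositive, so all its
    coordinates would vanish, against independence. *)
Lemma nonpos_count_lower k (W : 'M[algC]_(k, m)) (g : 'rV_k) :
  row_free W -> W *m A *m W ^t* = diag_mx g -> (forall i, g 0 i <= 0) ->
  (k <= #|[pred i | (d 0 i <= 0)%R]|)%N.
Proof.
move=> Wfree Wg g0; rewrite leqNgt; apply/negP => Jk.
have [c c0 cJ] := exists_vanishing_row (W *m P ^t*) Jk.
have := spectral_form (c *m W); rewrite (gram_form _ Wg) => E.
have T0 i : true -> 0 <= d 0 i * `|(c *m W *m P ^t*) 0 i| ^+ 2.
  move=> _; have [di|di] := boolP (d 0 i <= 0).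
    by rewrite -mulmxA cJ // normr0 expr0n mulr0.
  rewrite mulr_ge0 ?exprn_ge0 //.
  by rewrite ltW // real_ltNge ?spectral_diag_real // real0.
have S0 : \sum_i d 0 i * `|(c *m W *m P ^t*) 0 i| ^+ 2 = 0.
  apply/eqP; rewrite eq_le sumr_ge0 // andbT -E; apply: sumr_le0 => i _.
  by rewrite mulr_le0_ge0 ?exprn_ge0.
suff : c *m W = 0.
  move=> cW; case/eqP: c0; apply: (row_free_inj Wfree).
  by rewrite cW mul0mx.
apply: vP_eq0; apply/rowP=> i; rewrite [RHS]mxE.
have [di|di] := boolP (d 0 i <= 0); first by rewrite -mulmxA cJ.
have /eqP : d 0 i * `|(c *m W *m P ^t*) 0 i| ^+ 2 = 0 by exact: (psumr_eq0P T0 S0).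
rewrite mulf_eq0 expf_eq0 /= normr_eq0 => /orP[/eqP d0|/eqP //].
by rewrite d0 lexx in di.
Qed.

(** The mirror argument; since the norms are strictly positive, a nonzero coefficient vector already
    gives the contradiction. *)
Lemma pos_count_lower k (W : 'M[algC]_(k, m)) (g : 'rV_k) :
  W *m A *m W ^t* = diag_mx g -> (forall i, 0 < g 0 i) ->
  (k <= #|[pred i | (0 < d 0 i)%R]|)%N.
Proof.
move=> Wg g0; rewrite leqNgt; apply/negP => Jk.
have [c c0 cJ] := exists_vanishing_row (W *m P ^t*) Jk.
have := spectral_form (c *m W); rewrite (gram_form _ Wg) => E.
case/rV0Pn: c0 => i ci.
have : 0 < \sum_i g 0 i * `|c 0 i| ^+ 2.
  rewrite (bigD1 i) //= ltr_pwDl ?mulr_gt0 ?exprn_gt0 ?normr_gt0 //.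
  by apply: sumr_ge0 => j _; rewrite mulr_ge0 ?exprn_ge0 // ltW.
apply/negP; rewrite E -real_leNgt ?real0 //; last first.
  apply: rpred_sum => j _; rewrite rpredM ?spectral_diag_real //.
  by rewrite rpredX // normr_real.
apply: sumr_le0 => j _; have [dj|dj] := boolP (0 < d 0 j).
  by rewrite -mulmxA cJ // normr0 expr0n mulr0.
rewrite mulr_le0_ge0 ?exprn_ge0 //.
by rewrite real_leNgt ?spectral_diag_real // real0.
Qed.

End Inertia.

(** * The adjacency form on integer vectors *)

Section AdjacencyForm.
Variables (m : nat) (e : rel 'I_m).

(** Kept over the integers so that norms and orthogonality can be settled by computation, [lia] and
    [ring]; [frame_gram] transfers the results to [algC]. *)
Definition int_adj : 'M[int]_m := \matrix_(i, j) (e i j)%:R.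

Definition bform (u v : 'rV[int]_m) : int := (u *m int_adj *m v^T) 0 0.

Definition unitv (x : 'I_m) : 'rV[int]_m := delta_mx 0 x.

Lemma bformDl u v w : bform (u + v) w = bform u w + bform v w.
Proof. by rewrite /bform !mulmxDl mxE. Qed.

Lemma bformDr u v w : bform u (v + w) = bform u v + bform u w.
Proof. by rewrite /bform linearD mulmxDr mxE. Qed.

Lemma bformZl a u v : bform (a *: u) v = a * bform u v.
Proof. by rewrite /bform -!scalemxAl mxE. Qed.

Lemma bformZr a u v : bform u (a *: v) = a * bform u v.
Proof. by rewrite /bform linearZ /= -scalemxAr mxE. Qed.

Lemma bformNl u v : bform (- u) v = - bform u v.
Proof. by rewrite -scaleN1r bformZl mulN1r. Qed.

Lemma bformNr u v : bform u (- v) = - bform u v.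
Proof. by rewrite -scaleN1r bformZr mulN1r. Qed.

Lemma bform0l u : bform 0 u = 0. Proof. by rewrite -(scale0r 0) bformZl mul0r. Qed.

Lemma bform0r u : bform u 0 = 0. Proof. by rewrite -(scale0r 0) bformZr mul0r. Qed.

Lemma bform_suml (I : Type) (r : seq I) (P : pred I) (F : I -> 'rV_m) v :
  bform (\sum_(i <- r | P i) F i) v = \sum_(i <- r | P i) bform (F i) v.
Proof. exact: (big_morph (bform^~ v) (fun u w => bformDl u w v) (bform0l v)). Qed.

Lemma bform_sumr (I : Type) (r : seq I) (P : pred I) (F : I -> 'rV_m) u :
  bform u (\sum_(i <- r | P i) F i) = \sum_(i <- r | P i) bform u (F i).
Proof. exact: (big_morph (bform u) (bformDr u) (bform0r u)). Qed.

Definition bformE := (bformDl, bformDr, bformNl, bformNr, bformZl, bformZr).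

Lemma bform_unitv x y : bform (unitv x) (unitv y) = (e x y)%:R.
Proof.
rewrite /bform /unitv -rowE mxE (bigD1 y) //= big1 => [|i iy]; rewrite !mxE.
  by rewrite !eqxx mulr1 addr0.
by rewrite (negbTE iy) andbF mulr0.
Qed.

Lemma unitvE x y : unitv x 0 y = (x == y)%:R.
Proof. by rewrite mxE eqxx eq_sym. Qed.

Lemma coordD (u v : 'rV[int]_m) x : (u + v) 0 x = u 0 x + v 0 x.
Proof. by rewrite mxE. Qed.

Lemma coordN (u : 'rV[int]_m) x : (- u) 0 x = - u 0 x.
Proof. by rewrite mxE. Qed.

Lemma coordZ a (u : 'rV[int]_m) x : (a *: u) 0 x = a * u 0 x.
Proof. by rewrite mxE. Qed.

Definition coordE := (coordD, coordN, coordZ).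

Hypothesis e_simple : simple_graph e.

Let eC x y : e x y = e y x. Proof. by case: e_simple. Qed.

Lemma bformC u v : bform u v = bform v u.
Proof.
rewrite /bform; transitivity ((u *m int_adj *m v^T)^T 0 0); first by rewrite [RHS]mxE.
rewrite !trmx_mul trmxK mulmxA; congr ((_ *m _ *m _) 0 0).
by apply/matrixP=> i j; rewrite !mxE eC.
Qed.

Lemma adj_mx_herm : adj_mx e \is hermsymmx.
Proof.
apply: realsym_hermsym; last first.
  by apply/mxOverP=> i j; rewrite mxE realn.
by apply/is_hermitianmxP/matrixP=> i j; rewrite !mxE expr0 mul1r eC.
Qed.

(* The coordinate conditions make the vectors triangular, hence independent. *)
Definition orthogonal_frame (ps : seq ('rV[int]_m * 'I_m)) : bool :=
  all (fun p : 'rV[int]_m * 'I_m => p.1 0 p.2 != 0) ps &&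
  pairwise (fun p q : 'rV[int]_m * 'I_m =>
    (bform p.1 q.1 == 0) && (p.1 0 q.2 == 0)) ps.

Lemma frame_gram (ps : seq ('rV[int]_m * 'I_m)) : orthogonal_frame ps ->
  exists2 W : 'M[algC]_(size ps, m), row_free W &
    exists2 g : 'rV_(size ps),
      W *m adj_mx e *m W ^t* = diag_mx g &
      forall i, exists2 p, p \in ps & g 0 i = (bform p.1 p.1)%:~R.
Proof.
(* The empty list has no entry to serve as default for [nth]. *)
case: ps => [|p0 ps0].
  move=> _; exists 0; first by rewrite /row_free mxrank0.
  by exists 0; [apply/matrixP=> -[] | case].
set ps := p0 :: ps0 => /andP[/(all_nthP p0) ps1 /(pairwiseP p0) ps2].
pose p (i : 'I_(size ps)) := nth p0 ps i.
pose W : 'M[algC]_(size ps, m) := \matrix_(i, j) ((p i).1 0 j)%:~R.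
have WE i j : (W *m adj_mx e *m W ^t*) i j = (bform (p i).1 (p j).1)%:~R.
  rewrite /bform !mxE rmorph_sum /=; apply: eq_bigr => k _.
  rewrite !mxE rmorphM rmorph_sum /= conj_intr ?intr_int //; congr *%R.
  by apply: eq_bigr => l _; rewrite !mxE rmorphM /= rmorph_nat.
exists W.
  apply: (@triangular_row_free _ _ _ _ (fun i => (p i).2)) => [i|i j ij].
    by rewrite mxE intr_eq0 ps1.
  rewrite mxE; apply/eqP; rewrite intr_eq0.
  by have /(_ ij)/andP[] := ps2 i j (ltn_ord i) (ltn_ord j).
exists (\row_i (bform (p i).1 (p i).1)%:~R); last first.
  by move=> i; exists (p i); rewrite ?mxE // mem_nth.
apply/matrixP=> i j; rewrite WE !mxE.
have [->|ij] := eqVneq i j; first by rewrite mulr1n.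
apply/eqP; rewrite mulr0n intr_eq0; case: (ltngtP i j) => ij'.
- by have /(_ ij')/andP[] := ps2 i j (ltn_ord i) (ltn_ord j).
- by rewrite bformC; have /(_ ij')/andP[] := ps2 j i (ltn_ord j) (ltn_ord i).
- by rewrite (val_inj ij') eqxx in ij.
Qed.

Lemma at_least_nonposP k :
  reflect (at_least_nonpos_eigs k (adj_mx e))
    (k <= #|[pred i | (spectral_diag (adj_mx e) 0 i <= 0)%R]|)%N.
Proof.
apply: (iffP idP) => [ck|[rs [el kr]]]; last first.
  by rewrite -(eigenvalue_list_count adj_mx_herm (fun r => (r <= 0)%R) el).
have el := spectral_eigenvalue_list adj_mx_herm.
exists [seq spectral_diag (adj_mx e) 0 i | i <- enum 'I_m]; split=> //.
by rewrite (eigenvalue_list_count adj_mx_herm (fun r => (r <= 0)%R) el).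
Qed.

Lemma nonpos_frame_eigs ps : orthogonal_frame ps ->
  all (fun p => bform p.1 p.1 <= 0) ps -> at_least_nonpos_eigs (size ps) (adj_mx e).
Proof.
move=> /frame_gram[W Wfree [g Wg gE]] /allP ps0.
apply/at_least_nonposP; apply: (nonpos_count_lower adj_mx_herm Wfree Wg) => i.
by have [p pps ->] := gE i; rewrite lerz0 ps0.
Qed.

(** Nonpositive and positive eigenvalues are disjoint among the [m] spectral entries. *)
Lemma pos_frame_eigs k ps : orthogonal_frame ps ->
  all (fun p => 0 < bform p.1 p.1) ps -> at_least_nonpos_eigs k (adj_mx e) ->
  (k + size ps <= m)%N.
Proof.
move=> /frame_gram[W _ [g Wg gE]] /allP ps0 [rs [el kr]].
have g0 i : 0 < g 0 i by have [p pps ->] := gE i; rewrite ltr0z ps0.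
have := leq_add kr (pos_count_lower adj_mx_herm Wg g0).
rewrite (eigenvalue_list_count adj_mx_herm _ el) => /leq_trans -> //.
rewrite -[X in (_ <= X)%N](card_ord m).
rewrite -(cardC [pred i | (spectral_diag (adj_mx e) 0 i <= 0)%R]) leq_add2l.
by apply/subset_leq_card/subsetP=> i; rewrite !inE => /lt_geF ->.
Qed.

Hypothesis few : ~ at_least_nonpos_eigs 5 (adj_mx e).

(** Otherwise [z], with pivot [x], would extend the four vectors to a frame of five vectors of
    nonpositive norm. *)
Lemma bform_pos ps z x : size ps = 4%N -> orthogonal_frame ps ->
  all (fun p => bform p.1 p.1 <= 0) ps ->
  all (fun p : 'rV[int]_m * 'I_m => (bform p.1 z == 0) && (p.1 0 x == 0)) ps -> z 0 x != 0 ->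
  0 < bform z z.
Proof.
move=> sps /andP[ps1 ps2] ps0 psz zx; rewrite ltNge; apply/negP => z0.
apply: few; rewrite -[5%N]/(4.+1) -sps -(size_rcons ps (z, x)).
apply: nonpos_frame_eigs; last by rewrite all_rcons /= z0.
by rewrite /orthogonal_frame all_rcons pairwise_rcons /= zx ps1 ps2 psz.
Qed.

End AdjacencyForm.

(** * Graphs containing K5 *)

Section CliqueCase.
Variables (m : nat) (e : rel 'I_m).
Hypothesis e_simple : simple_graph e.
Hypothesis few : ~ at_least_nonpos_eigs 5 (adj_mx e).
Variable k : 'I_5 -> 'I_m.
Hypothesis k_clique : forall i j, e (k i) (k j) = (i != j).

Let eC x y : e x y = e y x. Proof. by case: e_simple. Qed.
Let eI x : e x x = false. Proof. by case: e_simple => _ /(_ x)/negbTE. Qed.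

Let k_inj : injective k.
Proof. by move=> i j kij; apply/eqP; rewrite -[_ == _]negbK -k_clique kij eI. Qed.

Let f (i : 'I_5) := unitv (k i).

(** An orthogonal basis of the sum-zero vectors on the clique, where the form J - I is negative
    definite; the pivot is the last vertex in each support. *)
Let clique_frame : seq ('rV[int]_m * 'I_m) :=
  [:: (f 0 - f 1, k 1); (f 0 + f 1 - 2 *: f 2, k 2);
      (f 0 + f 1 + f 2 - 3 *: f 3, k 3);
      (f 0 + f 1 + f 2 + f 3 - 4 *: f 4, k 4)].

Let bform_f i j : bform e (f i) (f j) = (i != j)%:R.
Proof. by rewrite bform_unitv k_clique. Qed.

Let f_at i j : f i 0 (k j) = (i == j)%:R.
Proof. by rewrite unitvE (inj_eq k_inj). Qed.

Let clique_frameP : orthogonal_frame e clique_frame &&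
  all (fun p => bform e p.1 p.1 <= 0) clique_frame.
Proof.
by rewrite /orthogonal_frame /= !(bformE, bform_f) !coordE !f_at.
Qed.

Definition nbr (v : 'I_m) (i : 'I_5) : int := (e v (k i))%:R.
Definition wt (v : 'I_m) : int := \sum_i nbr v i.
Definition common (u v : 'I_m) : int := \sum_i nbr u i * nbr v i.

(* [schur_gram] is 4 times the Schur complement of the clique block, and [hat v]
   is 4 times the projection of the unit vector at v off the span of the clique. *)
Definition schur_gram (u v : 'I_m) : int :=
  4 * (e u v)%:R + 4 * common u v - wt u * wt v.
Definition hat (v : 'I_m) : 'rV[int]_m :=
  4 *: unitv v + \sum_i (4 * nbr v i - wt v) *: f i.

(** The clique coefficients sum to [- wt v], so J - I sends them to [- 4 * nbr v j], which cancels
    the contribution of [4 *: unitv v]. *)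
Lemma bform_hat_clique v j : bform e (hat v) (f j) = 0.
Proof.
rewrite /hat bformDl bformZl bform_unitv bform_suml.
have -> : \sum_i bform e ((4 * nbr v i - wt v) *: f i) (f j) =
    \sum_i (4 * nbr v i - wt v) - (4 * nbr v j - wt v).
  rewrite [in RHS](bigD1 j) //= addrAC subrr add0r (bigD1 j) //= bformZl bform_f eqxx mulr0 add0r.
  by apply: eq_bigr => i /negbTE ij; rewrite bformZl bform_f ij mulr1.
rewrite sumrB -mulr_sumr -/(wt v) sumr_const card_ord -/(nbr v j).
by rewrite -mulr_natr; ring.
Qed.

Lemma bform_hat u v : bform e (hat u) (hat v) = 4 * schur_gram u v.
Proof.
rewrite {2}/hat bformDr bform_sumr big1 => [|i _]; last first.
  by rewrite bformZr bform_hat_clique mulr0.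
rewrite addr0 bformZr; congr (_ * _).
rewrite /hat bformDl bformZl bform_unitv bform_suml.
have -> : \sum_i bform e ((4 * nbr u i - wt u) *: f i) (unitv v) =
    \sum_i (4 * (nbr u i * nbr v i) - wt u * nbr v i).
  by apply: eq_bigr => i _; rewrite bformZl bform_unitv eC -/(nbr v i); ring.
by rewrite sumrB -!mulr_sumr -/(wt v) -/(common u v) /schur_gram; ring.
Qed.

Let outside := [set v | [forall i, v != k i]].

Let hat_at u v : v \in outside -> hat u 0 v = 4 * (u == v)%:R.
Proof.
rewrite inE => /forallP vk; rewrite /hat !coordE unitvE summxE big1 ?addr0 // => i _.
by rewrite coordZ unitvE eq_sym (negbTE (vk i)) mulr0.
Qed.

(** Positive definiteness of the Schur complement, for combinations given as weighted lists. The
    combination of the [hat] vectors is orthogonal to [clique_frame]; as [x] does not recur in [s],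
    its coordinate at [x] is [4 * c]. *)
Lemma schur_gram_pos (c : int) x (s : seq (int * 'I_m)) :
  c != 0 -> x \in outside -> x \notin unzip2 s ->
  0 < \sum_(p <- (c, x) :: s) \sum_(q <- (c, x) :: s)
        p.1 * q.1 * schur_gram p.2 q.2.
Proof.
move=> c0 xO xs; set t := (c, x) :: s.
pose z := \sum_(p <- t) p.1 *: hat p.2.
have zz : bform e z z =
    4 * \sum_(p <- t) \sum_(q <- t) p.1 * q.1 * schur_gram p.2 q.2.
  rewrite bform_suml mulr_sumr; apply: eq_bigr => p _.
  rewrite bform_sumr mulr_sumr; apply: eq_bigr => q _.
  rewrite bformZl bformZr bform_hat; move: p.1 q.1 (schur_gram _ _) => a b g; ring.
have zf j : bform e (f j) z = 0.
  rewrite bform_sumr big1 // => p _.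
  by rewrite bformZr bformC // bform_hat_clique mulr0.
have zx : z 0 x = 4 * c.
  rewrite /z summxE big_cons coordZ hat_at //= eqxx mulr1 mulrC big1_seq ?addr0 //.
  move=> p /andP[_ ps]; rewrite coordZ hat_at //; case: eqP => [px|]; last by rewrite !mulr0.
  by rewrite -px map_f in xs.
have fx j : f j 0 x = 0.
  by move: xO; rewrite inE => /forallP/(_ j); rewrite unitvE eq_sym => /negbTE ->.
have /andP[fr neg] := clique_frameP.
have : 0 < bform e z z.
  apply: (bform_pos e_simple few _ fr neg (x := x)) => //.
    by rewrite /= !bformE !zf !coordE !fx.
  by rewrite zx mulf_neq0.
by rewrite zz pmulr_rgt0.
Qed.

Let common_diag v : common v v = wt v.
Proof. by apply: eq_bigr => i _; rewrite /nbr; case: e. Qed.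

Let commonC u v : common u v = common v u.
Proof. by apply: eq_bigr => i _; rewrite mulrC. Qed.

Let schur_gramC u v : schur_gram u v = schur_gram v u.
Proof. by rewrite /schur_gram commonC eC; ring. Qed.

Let schur_gram_diag v : schur_gram v v = wt v * (4 - wt v).
Proof. by rewrite /schur_gram common_diag eI mulr0n; ring. Qed.

Let wt_range v : v \in outside -> [|| wt v == 1, wt v == 2 | wt v == 3].
Proof.
move=> vO; have := @schur_gram_pos 1 v [::] isT vO isT.
rewrite unlock /= schur_gram_diag.
nia.
Qed.

(** Positivity at u + v and at u - v. *)
Let schur_gram_pair u v : u \in outside -> v \in outside -> u != v ->
  2 * `|schur_gram u v| < schur_gram u u + schur_gram v v.
Proof.
move=> uO vO uv.
have vs : u \notin [:: v] by rewrite inE.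
have := @schur_gram_pos 1 u [:: (1, v)] isT uO vs.
have := @schur_gram_pos 1 u [:: (-1, v)] isT uO vs.
by rewrite unlock /= (schur_gramC v u); lia.
Qed.

Definition odd_wt v := (wt v == 1) || (wt v == 3).
(** It is 1 on weight 1 and -1 on weight 3; with these signs, distinct odd vertices have Schur
    product -1. *)
Definition sgn_wt v : int := 2 - wt v.

(** Modulo 4 the entry is [- wt u * wt v], and [schur_gram_pair] bounds it by the norms, 3 for odd
    weight and 4 for weight 2. Residue and bound determine it here and in the next two lemmas, up to
    sign in the mixed case. *)
Let odd_pair u v : u \in outside -> v \in outside -> u != v ->
  odd_wt u -> odd_wt v -> sgn_wt u * sgn_wt v * schur_gram u v = -1.
Proof.
move=> uO vO uv; have := schur_gram_pair uO vO uv.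
rewrite !schur_gram_diag /schur_gram /sgn_wt.
by move=> + /orP[]/eqP u1 /orP[]/eqP v1; rewrite u1 v1; case: (e u v); lia.
Qed.

Let even_pair u v : u \in outside -> v \in outside -> u != v ->
  wt u = 2 -> wt v = 2 -> schur_gram u v = 0.
Proof.
move=> uO vO uv; have := schur_gram_pair uO vO uv.
rewrite !schur_gram_diag /schur_gram => + u2 v2; rewrite u2 v2.
by case: (e u v); lia.
Qed.

Let mixed_pair u v : u \in outside -> v \in outside ->
  odd_wt u -> wt v = 2 -> (schur_gram u v == 2) || (schur_gram u v == -2).
Proof.
move=> uO vO ou v2.
have uv : u != v by apply: contraTneq ou => ->; rewrite /odd_wt v2.
have := schur_gram_pair uO vO uv.
rewrite !schur_gram_diag /schur_gram v2.
by case/orP: ou => /eqP->; case: (e u v); lia.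
Qed.

(** The signed sum of four odd vertices would have norm 4 * 3 - 12 = 0. *)
Let card_odd : (#|[set v in outside | odd_wt v]| <= 3)%N.
Proof.
rewrite leqNgt; apply/negP => /card_geqP[s [us ss sO]].
case: s ss us sO => [|a [|b [|c [|d []]]]] //= _.
rewrite !inE !negb_or -!andbA !andbT => /andP[ab /andP[ac /andP[ad /and3P[bc bd cd]]]] sO.
have H x : x \in [:: a; b; c; d] -> x \in outside /\ odd_wt x.
  by move=> /sO; rewrite inE => /andP.
have [[aO oa] [bO ob]] := (H a ltac:(by rewrite !inE eqxx),
                           H b ltac:(by rewrite !inE eqxx ?orbT)).
have [[cO oc] [dO od]] := (H c ltac:(by rewrite !inE eqxx ?orbT),
                           H d ltac:(by rewrite !inE eqxx ?orbT)).
have s0 : sgn_wt a != 0 by case/orP: oa => /eqP; rewrite /sgn_wt => ->.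
have as' : a \notin unzip2 [:: (sgn_wt b, b); (sgn_wt c, c); (sgn_wt d, d)].
  by rewrite !inE !negb_or ab ac ad.
have := schur_gram_pos s0 aO as'.
rewrite unlock /= !addr0 !schur_gram_diag.
rewrite (schur_gramC b a) (schur_gramC c a) (schur_gramC d a).
rewrite (schur_gramC c b) (schur_gramC d b) (schur_gramC d c).
have := (odd_pair aO bO ab oa ob, odd_pair aO cO ac oa oc, odd_pair aO dO ad oa od).
have := (odd_pair bO cO bc ob oc, odd_pair bO dO bd ob od, odd_pair cO dO cd oc od).
have N x : odd_wt x -> sgn_wt x * sgn_wt x * (wt x * (4 - wt x)) = 3.
  by case/orP=> /eqP; rewrite /sgn_wt => ->.
rewrite !N // ![sgn_wt b * sgn_wt a]mulrC ![sgn_wt c * sgn_wt a]mulrC.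
rewrite ![sgn_wt d * sgn_wt a]mulrC ![sgn_wt c * sgn_wt b]mulrC.
rewrite ![sgn_wt d * sgn_wt b]mulrC ![sgn_wt d * sgn_wt c]mulrC.
by move=> [[-> ->] ->] [[-> ->] ->].
Qed.

Let card_even_mixed x : x \in outside -> odd_wt x ->
  (#|[set v in outside | (wt v == 2)%R]| <= 2)%N.
Proof.
move=> xO ox; rewrite leqNgt; apply/negP => /card_geqP[s [us ss sO]].
case: s ss us sO => [|a [|b [|c []]]] //= _.
rewrite !inE !negb_or -!andbA !andbT => /and3P[ab ac bc] sO.
have H y : y \in [:: a; b; c] -> y \in outside /\ wt y = 2.
  by move=> /sO; rewrite inE => /andP[? /eqP].
have [aO a2] := H a ltac:(by rewrite !inE eqxx).
have [bO b2] := H b ltac:(by rewrite !inE eqxx ?orbT).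
have [cO c2] := H c ltac:(by rewrite !inE eqxx ?orbT).
have xn y : wt y = 2 -> x != y.
  by move=> y2; apply: contraTneq ox => ->; rewrite /odd_wt y2.
have xs (p q r : int) : x \notin unzip2 [:: (p, a); (q, b); (r, c)].
  by rewrite !inE !negb_or !xn.
(* Four times the projection of [x] off the orthogonal vectors [a], [b], [c] of norm 4. The entries
   being 2 or -2, its norm is 16 * 3 - 4 * (4 + 4 + 4) = 0. *)
have := @schur_gram_pos 4 x [:: (- schur_gram x a, a); (- schur_gram x b, b);
  (- schur_gram x c, c)] isT xO (xs _ _ _).
rewrite unlock /= !addr0 !schur_gram_diag.
rewrite (schur_gramC a x) (schur_gramC b x) (schur_gramC c x).
rewrite (schur_gramC b a) (schur_gramC c a) (schur_gramC c b).
rewrite (even_pair aO bO ab a2 b2) (even_pair aO cO ac a2 c2).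
rewrite (even_pair bO cO bc b2 c2) a2 b2 c2.
have [[ma mb] mc] := (mixed_pair xO aO ox a2, mixed_pair xO bO ox b2, mixed_pair xO cO ox c2).
by case/orP: ox => /eqP->; case/orP: ma => /eqP->; case/orP: mb => /eqP->;
   case/orP: mc => /eqP->.
Qed.

(** Two such vertices with the same neighbours in the clique would have [common] equal to 2, hence a
    Schur entry at least 4, against [even_pair]. So they inject into the ten 2-subsets of the
    clique. *)
Let card_even : (#|[set v in outside | (wt v == 2)%R]| <= 10)%N.
Proof.
pose nb v := [set i | e v (k i)].
have wt_nb v : wt v = #|nb v|%:R.
  rewrite /wt /nbr -natr_sum -sum1_card; congr _%:R.
  by rewrite [RHS]big_mkcond; apply: eq_bigr => i _; rewrite inE; case: e.
have nb_inj : {in [set v in outside | (wt v == 2)%R] &, injective nb}.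
  move=> u v; rewrite 2!in_set => /andP[uO /eqP u2] /andP[vO /eqP v2] uv.
  apply/eqP/negPn/negP => neq_uv; have := even_pair uO vO neq_uv u2 v2.
  suff c2 : common u v = 2 by rewrite /schur_gram c2 u2 v2; case: (e u v).
  rewrite -u2 -(common_diag u); apply: eq_bigr => i _; congr (_ * _).
  by move/setP/(_ i): uv; rewrite /nbr !in_set => ->.
rewrite -(card_in_imset nb_inj).
have -> : 10%N = #|[set B : {set 'I_5} | #|B| == 2%N]|.
  by rewrite card_draws card_ord.
apply/subset_leq_card/subsetP => B /imsetP[v]; rewrite in_set => /andP[_ v2] ->.
by move: v2; rewrite in_set wt_nb (eqr_nat _ _ 2).
Qed.

Lemma clique_bound : (m <= 15)%N.
Proof.
have kO : ~: outside = [set k i | i in 'I_5].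
  apply/setP=> v; rewrite !inE negb_forall.
  by apply/existsP/imsetP=> [[i]|[i _ ->]];
    [rewrite negbK => /eqP; exists i | exists i; rewrite negbK].
have := cardsC outside; rewrite kO card_imset // !card_ord => <-.
rewrite (leq_add2r 5 _ 10).
have sub : outside \subset [set v in outside | odd_wt v] :|: [set v in outside | wt v == 2].
  apply/subsetP=> v vO; rewrite in_setU [X in X || _]in_set [X in _ || X]in_set vO /=.
  by rewrite /odd_wt; case/or3P: (wt_range vO) => ->; rewrite ?orbT.
have {sub} := leq_trans (subset_leq_card sub) (leq_card_setU _ _).
move/leq_trans; apply.
(* Without odd vertices at most 10 remain outside; with one, at most 3 + 2. *)
have [->|[x]] := set_0Vmem [set v in outside | odd_wt v].
  by rewrite cards0 card_even.
rewrite in_set => /andP[xO ox].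
exact: leq_trans (leq_add card_odd (card_even_mixed xO ox)) _.
Qed.

End CliqueCase.

(** * Graphs with independence number three *)

Section IndependentTriple.
Variables (m : nat) (e : rel 'I_m).
Hypothesis e_simple : simple_graph e.
Hypothesis few : ~ at_least_nonpos_eigs 5 (adj_mx e).
Hypothesis alpha3 :
  forall A : {set 'I_m}, {in A &, forall x y, ~~ e x y} -> (#|A| <= 3)%N.
Variable s : 'I_3 -> 'I_m.
Hypothesis s_inj : injective s.
Hypothesis s_indep : forall i j, ~~ e (s i) (s j).

Let eC x y : e x y = e y x. Proof. by case: e_simple. Qed.
Let eI x : e x x = false. Proof. by case: e_simple => _ /(_ x)/negbTE. Qed.

Let outside := ~: [set s i | i in 'I_3].

Let outsideP v i : v \in outside -> (s i == v) = false.
Proof. by rewrite in_setC; apply: contraNF => /eqP <-; rewrite imset_f. Qed.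

(** The three independent vertices are null vectors; [d] with pivot [t] is the fourth frame vector,
    and [x] is the pivot of [z]. *)
Lemma triple_pos d z t x : t \in outside -> x \in outside ->
  (forall i, bform e (unitv (s i)) d = 0) ->
  (forall i, bform e (unitv (s i)) z = 0) ->
  bform e d d <= 0 -> bform e d z = 0 -> d 0 t != 0 -> d 0 x = 0 -> z 0 x != 0 ->
  0 < bform e z z.
Proof.
move=> tO xO sd sz dd dz dt dx zx.
pose f i := (unitv (s i), s i).
have ss i j : bform e (unitv (s i)) (unitv (s j)) = 0.
  by rewrite bform_unitv (negbTE (s_indep i j)).
have sa i j : unitv (s i) 0 (s j) = (i == j)%:R by rewrite unitvE (inj_eq s_inj).
have so i v : v \in outside -> unitv (s i) 0 v = 0.
  by move=> vO; rewrite unitvE outsideP.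
apply: (bform_pos e_simple few (ps := [:: f 0; f 1; f 2; (d, t)])) zx => //.
- by rewrite /orthogonal_frame /= !ss !sa !sd !so // dt.
- by rewrite /= !ss !lexx dd.
- by rewrite /= !sz !so // dz dx.
Qed.

Definition trace v := [set i | e v (s i)].
Definition twins u v :=
  [&& u \in outside, v \in outside, u != v & trace u == trace v].

Let twinsP u v : twins u v ->
  [/\ u \in outside, v \in outside, u != v & forall i, e u (s i) = e v (s i)].
Proof.
case/and4P=> uO vO uv /eqP/setP tuv; split=> // i.
by have := tuv i; rewrite !in_set.
Qed.

Let e_outside u i : bform e (unitv (s i)) (unitv u) = (e u (s i))%:R.
Proof. by rewrite bform_unitv eC. Qed.

(** For disjoint pairs the differences d and d' have norm -2 and are orthogonal to the triple. Their
    product c has two positive and two negative terms, so |c| <= 2; then 2d' + cd is orthogonal to d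
    and has norm 2c^2 - 8 <= 0. *)
Lemma adjacent_twins_meet u v u' v' : twins u v -> e u v -> twins u' v' -> e u' v' ->
  uniq [:: u; v; u'; v'] -> False.
Proof.
move=> /twinsP[uO vO _ tuv] uv /twinsP[uO' vO' _ tuv'] uv'.
rewrite /= !inE !negb_or -!andbA => /and5P[_ uu' uv1 vu' /and3P[vv' u'v' _]].
have [d dE] : exists d, d = unitv u - unitv v by exists (unitv u - unitv v).
have [d' dE'] : exists d, d = unitv u' - unitv v' by exists (unitv u' - unitv v').
have sd i : bform e (unitv (s i)) d = 0 by rewrite dE !bformE !e_outside tuv subrr.
have sd' i : bform e (unitv (s i)) d' = 0 by rewrite dE' !bformE !e_outside tuv' subrr.
have dd : bform e d d = -2 by rewrite dE !bformE !bform_unitv !eI (eC v) uv.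
have dd' : bform e d' d' = -2 by rewrite dE' !bformE !bform_unitv !eI (eC v') uv'.
have vu : (v == u) = false by apply: contraTF uv => /eqP ->; rewrite eI.
have v'u' : (v' == u') = false by apply: contraTF uv' => /eqP ->; rewrite eI.
have cb : `|bform e d d'| <= 2.
  by rewrite dE dE' !bformE !bform_unitv; do 4!case: (e _ _).
have : 0 < bform e (2 *: d' + bform e d d' *: d) (2 *: d' + bform e d d' *: d).
  apply: (triple_pos uO uO' (d := d)) => //.
  - by move=> i; rewrite !bformE sd sd' !mulr0.
  - by rewrite dd.
  - by rewrite !bformE dd; ring.
  - by rewrite ?dE ?dE' !coordE !unitvE eqxx vu.
  - by rewrite ?dE ?dE' !coordE !unitvE (negbTE uu') (negbTE vu').
  - by rewrite ?dE ?dE' !coordE !unitvE eqxx (negbTE uu') (negbTE vu') v'u' !subr0 mulr0 addr0.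
rewrite !bformE dd dd' (bformC e_simple d' d).
move: (bform e d d') cb => c; rewrite ler_norml => /andP[c1 c2].
apply/negP; rewrite -leNgt -subr_ge0.
rewrite (_ : _ - _ = 2 * ((2 - c) * (c + 2))); last by ring.
by rewrite !mulr_ge0 // ?subr_ge0 // -lerBlDr sub0r.
Qed.

(** If the edge count is not 1, two of the vertices, say v and w, have the same adjacency p to the
    third, u, with p = 1 or vw not an edge. Then v - w and v + w - 2u are orthogonal, with
    nonpositive norms -2a and 2a - 8p, where a is the adjacency of v and w. *)
Lemma twin_triple u v w : twins u v -> twins u w -> v != w ->
  (e u v + e u w + e v w = 1)%N.
Proof.
move=> /twinsP[uO vO uv tuv] /twinsP[_ wO uw tuw] vw.
have su i : bform e (unitv (s i)) (unitv u) = (e u (s i))%:R by exact: e_outside.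
have sv i : bform e (unitv (s i)) (unitv v) = (e u (s i))%:R by rewrite e_outside tuv.
have sw i : bform e (unitv (s i)) (unitv w) = (e u (s i))%:R by rewrite e_outside tuw.
pose scale (a : int) (x : 'rV[int]_m) : 'rV[int]_m := a *: x.
pose lin a b c := scale a (unitv u) + scale b (unitv v) + scale c (unitv w).
(* Twins have equal products with the triple, so zero coefficient sum means orthogonality to it. *)
have key (a b c p q r : int) t x : a + b + c = 0 -> p + q + r = 0 ->
    t \in outside -> x \in outside ->
    let d := lin a b c in
    let z := lin p q r in
    bform e d d <= 0 -> bform e d z = 0 -> d 0 t != 0 -> d 0 x = 0 -> z 0 x != 0 ->
    0 < bform e z z.
  move=> abc pqr tO xO d z; apply: (triple_pos tO xO) => i.
    by rewrite /d /lin /scale !bformE su sv sw -!mulrDl abc mul0r.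
  by rewrite /z /lin /scale !bformE su sv sw -!mulrDl pqr mul0r.
have [vu wu wv] : [/\ v != u, w != u & w != v] by split; rewrite eq_sym.
have uvw := (negbTE uv, negbTE vu, negbTE uw, negbTE wu, negbTE vw, negbTE wv, eqxx).
have := key 1 (-1) 0 1 0 (-1) u w erefl erefl uO wO.
have := key 1 0 (-1) 1 (-2) 1 u v erefl erefl uO vO.
have := key 1 (-1) 0 1 1 (-2) u w erefl erefl uO wO.
have := key 0 1 (-1) (-2) 1 1 v u erefl erefl vO uO.
rewrite /lin /scale !bformE !bform_unitv !coordE !unitvE !uvw !eI (eC v u) (eC w u) (eC w v).
by case: (e u v); case: (e u w); case: (e v w) => //= H1 H2 H3 H4;
  first [by have := H1 isT erefl isT erefl isT | by have := H2 isT erefl isT erefl isT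
        | by have := H3 isT erefl isT erefl isT | by have := H4 isT erefl isT erefl isT].
Qed.

Let cls X := [set v in outside | trace v == X].

Let clsE X v : (v \in cls X) = (v \in outside) && (trace v == X).
Proof. exact: in_set. Qed.

Let cls_twins X u v : u \in cls X -> v \in cls X -> u != v -> twins u v.
Proof.
rewrite !clsE => /andP[uO /eqP tu] /andP[vO /eqP tv] uv.
by rewrite /twins uO vO uv tu tv eqxx.
Qed.

Let adjacent_class X := [exists u in cls X, exists v in cls X, e u v].

Let adjacent_classP X :
  reflect (exists u v, [/\ u \in cls X, v \in cls X & e u v]) (adjacent_class X).
Proof.
apply: (iffP exists_inP) => [[u uX /exists_inP[v vX uv]]|[u [v [uX vX uv]]]].
  by exists u, v.
by exists u => //; apply/exists_inP; exists v.
Qed.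

Let e_neq u v : e u v -> u != v.
Proof. by apply: contraTneq => ->; rewrite eI. Qed.

Lemma adjacent_class_unique X Y : adjacent_class X -> adjacent_class Y -> X = Y.
Proof.
move=> /adjacent_classP[u [v [uX vX uv]]] /adjacent_classP[u' [v' [uY vY uv']]].
apply/eqP/negPn/negP => XY.
have neq x y : x \in cls X -> y \in cls Y -> x != y.
  rewrite !clsE => /andP[_ /eqP xX] /andP[_ /eqP yY].
  by apply: contraNneq XY => xy; rewrite -xX -yY xy.
apply: (adjacent_twins_meet (cls_twins uX vX (e_neq uv)) uv
         (cls_twins uY vY (e_neq uv')) uv').
by rewrite /= !inE !negb_or (e_neq uv) (e_neq uv') (neq u u') ?(neq u v')
  ?(neq v u') ?(neq v v').
Qed.

(** Among four twins each of the four triples has exactly one edge. Every edge lies in two triples,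
    so there are two edges; they share no vertex, contradicting [adjacent_twins_meet]. *)
Lemma card_class_le3 X : (#|cls X| <= 3)%N.
Proof.
rewrite leqNgt; apply/negP => /card_geqP[t [ut st tX]].
case: t ut st tX => [|a [|b [|c [|d []]]]] //= + _.
rewrite !inE !negb_or -!andbA !andbT => /andP[ab /andP[ac /andP[ad /and3P[bc bd cd]]]] tX.
have [[aX bX] [cX dX]] : (a \in cls X /\ b \in cls X) /\ (c \in cls X /\ d \in cls X).
  by split; split; apply: tX; rewrite !inE eqxx ?orbT.
have tw := cls_twins.
have [H1 H2] := (twin_triple (tw _ _ _ aX bX ab) (tw _ _ _ aX cX ac) bc,
                 twin_triple (tw _ _ _ aX bX ab) (tw _ _ _ aX dX ad) bd).
have [H3 H4] := (twin_triple (tw _ _ _ aX cX ac) (tw _ _ _ aX dX ad) cd,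
                 twin_triple (tw _ _ _ bX cX bc) (tw _ _ _ bX dX bd) cd).
have no x y z t : x \in cls X -> y \in cls X -> z \in cls X -> t \in cls X ->
    uniq [:: x; y; z; t] -> e x y -> e z t -> False.
  move=> xX yX zX tX' ux xy zt.
  exact: (adjacent_twins_meet (tw _ _ _ xX yX (e_neq xy)) xy
           (tw _ _ _ zX tX' (e_neq zt)) zt ux).
have := (no a b c d aX bX cX dX, no a c b d aX cX bX dX, no a d b c aX dX bX cX).
have [da cb db dc] : [/\ d != a, c != b, d != b & d != c] by split; rewrite eq_sym.
rewrite /= !inE !negb_or ab ac ad bc bd cd ?da ?cb ?db ?dc /= => -[[N1 N2] N3].
move: (e a b) (e a c) (e a d) (e b c) (e b d) (e c d) H1 H2 H3 H4 N1 N2 N3.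
by do 6![case] => //= _ _ _ _ N1 N2 N3; [case: N1|case: N2|case: N3].
Qed.

(** [u], [v] and the triple vertices outside [X] are 5 - |X| independent vertices, and at most 3 are
    allowed. *)
Let nonadjacent_class X u v : u \in cls X -> v \in cls X -> ~~ e u v -> u != v ->
  (2 <= #|X|)%N.
Proof.
move=> uX vX uv neq_uv; pose A := [set u; v] :|: [set s i | i in ~: X].
have tX x : x \in cls X -> forall i, i \in ~: X -> ~~ e x (s i).
  rewrite clsE => /andP[_ /eqP <-] i.
  by rewrite in_setC in_set.
have : (#|A| <= 3)%N.
  apply: alpha3 => x y /setUP[] xA /setUP[] yA.
  - by move: xA yA => /set2P[]-> /set2P[]->; rewrite ?eI // eC.
  - by case/imsetP: yA => i iX ->; case/set2P: xA => ->; rewrite tX.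
  - by case/imsetP: xA => i iX ->; rewrite eC; case/set2P: yA => ->; rewrite tX.
  - by case/imsetP: xA => i _ ->; case/imsetP: yA => j _ ->.
rewrite cardsU cards2 neq_uv (_ : _ :&: _ = set0) ?cards0 ?subn0; last first.
  apply/setP=> x; rewrite in_setI in_set0; apply/negP => /andP[xuv /imsetP[i _ xi]].
  have : x \in outside by case/set2P: xuv => ->; [move: uX|move: vX]; rewrite clsE => /andP[].
  by rewrite in_setC xi imset_f.
rewrite card_imset // => A3; have := cardsC X; rewrite card_ord; lia.
Qed.

(** A vertex with empty trace would extend the triple to four independent vertices. A class of three
    contains an edge and a non-edge by [twin_triple], so it is adjacent and |X| >= 2; a class of two
    without an edge also needs |X| >= 2. *)
Let class_bound X : (#|cls X| <= minn #|X| 2 + adjacent_class X)%N.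
Proof.
have [X0|Xn0] := posnP #|X|.
  rewrite X0 min0n add0n; case: (set_0Vmem (cls X)) => [->|[v vX]]; first by rewrite cards0.
  have vO : v \in outside by move: vX; rewrite clsE => /andP[].
  have vs i : e v (s i) = false.
    have /eqP := X0; rewrite cards_eq0 => /eqP X00.
    by move: vX; rewrite clsE X00 => /andP[_ /eqP/setP/(_ i)]; rewrite !in_set.
  have : (#|v |: [set s i | i in 'I_3]| <= 3)%N.
    apply: alpha3 => x y /setU1P[->|/imsetP[i _ ->]] /setU1P[->|/imsetP[j _ ->]].
    - by rewrite eI.
    - by rewrite vs.
    - by rewrite eC vs.
    - exact: s_indep.
  by rewrite cardsU1 card_imset // card_ord; move: vO; rewrite in_setC => ->.
have triple : (2 < #|cls X|)%N -> exists u v w, [/\ u \in cls X, v \in cls X, w \in cls X &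
    [/\ u != v, u != w, v != w & (e u v + e u w + e v w = 1)%N]].
  case/card_geqP=> t [ut st tX].
  case: t ut st tX => [|a [|b [|c []]]] //= + _.
  rewrite !inE !negb_or -!andbA !andbT => /and3P[ab ac bc] tX.
  have [aX bX cX] : [/\ a \in cls X, b \in cls X & c \in cls X].
    by split; apply: tX; rewrite !inE eqxx ?orbT.
  exists a, b, c; split=> //; split=> //.
  exact: (twin_triple (cls_twins aX bX ab) (cls_twins aX cX ac) bc).
have big2 : (2 < #|cls X|)%N -> (2 <= #|X|)%N /\ adjacent_class X.
  case/triple=> u [v [w [uX vX wX [uv uw vw E]]]]; split.
    have : ~~ e u v \/ ~~ e u w by move: E; case: (e u v); case: (e u w); auto.
    by case=> [?|?]; [apply: (nonadjacent_class uX vX)|apply: (nonadjacent_class uX wX)].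
  apply/adjacent_classP.
  have [xy|xy] := boolP (e u v); first by exists u, v.
  have [xz|xz] := boolP (e u w); first by exists u, w.
  by exists v, w; split=> //; move: E; rewrite (negbTE xy) (negbTE xz); case: e.
have big1 : (1 < #|cls X|)%N -> ~~ adjacent_class X -> (2 <= #|X|)%N.
  case/card_geqP=> t [ut st tX] nadj.
  case: t ut st tX => [|a [|b []]] //= + _; rewrite inE andbT => ab tX.
  have [aX bX] : a \in cls X /\ b \in cls X.
    by split; apply: tX; rewrite !inE eqxx ?orbT.
  apply: (nonadjacent_class aX bX) => //.
  by apply: contraNN nadj => eab; apply/adjacent_classP; exists a, b.
have := card_class_le3 X; move: Xn0 big1 big2 {triple}.
move: #|cls X| #|X| (adjacent_class X) => a b [] /=.
  by move=> b0 _ big2 a3; have [|/big2[b2 _]] := leqP a 2; lia.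
move=> b0 big1 big2 a3; have [a2|/big2[]//] := leqP a 2.
by have [|/big1/(_ isT)] := leqP a 1; lia.
Qed.

Let sum_minn : \sum_(X : {set 'I_3}) minn #|X| 2 = 11%N.
Proof.
(* Sorted by size, the traces of sizes 1, 2 and 3 contribute 3 + 6 + 2. *)
rewrite (partition_big (fun X : {set 'I_3} => inord #|X| : 'I_4) xpredT) //=.
transitivity (\sum_(k < 4) 'C(3, k) * minn k 2)%N; last by rewrite !big_ord_recr big_ord0.
apply: eq_bigr => k _; rewrite (eq_bigl (fun X : {set 'I_3} => #|X| == k)); last first.
  move=> X; rewrite -val_eqE /= inordK //.
  by rewrite ltnS -[X in (_ <= X)%N](card_ord 3) max_card.
rewrite (eq_bigr (fun=> minn k 2)) => [|X /eqP -> //].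
by rewrite sum_nat_const -cardsE card_draws card_ord.
Qed.

Lemma independent_triple_bound : (m <= 15)%N.
Proof.
have := cardsC [set s i | i in 'I_3]; rewrite card_imset // !card_ord => <-.
rewrite -/outside (leq_add2l 3 _ 12).
rewrite -sum1_card (partition_big trace xpredT) //=.
apply: (@leq_trans (\sum_(X : {set 'I_3}) (minn #|X| 2 + adjacent_class X))%N).
  by apply: leq_sum => X _; rewrite sum1dep_card class_bound.
(* The sizes account for 11, and the only possible adjacent class for one more. *)
rewrite big_split /= sum_minn (leq_add2l 11 _ 1).
have [X XX|none] := pickP adjacent_class; last by rewrite big1 // => X _; rewrite none.
rewrite (bigD1 X) //= big1 ?addn0 ?leq_b1 // => Y; apply: contraNeq.
by rewrite eqb0 negbK => YY; rewrite (adjacent_class_unique YY XX).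
Qed.

End IndependentTriple.

(** * Refutation of twelve traces by unit propagation *)

Definition label : Type := (bool * bool * bool * bool)%type.

Definition label0 : label := (false, false, false, false).

Definition label_bits (x : label) : seq bool :=
  let: (a, b, c, d) := x in [:: a; b; c; d].

Definition labels : seq label :=
  let bs := [:: false; true] in
  [seq (p, q.1, q.2) | p <- [seq (a, b) | a <- bs, b <- bs],
                       q <- [seq (c, d) | c <- bs, d <- bs]].

Definition balanced (p q : label * label) : bool :=
  map (fun b : bool * bool => b.1 + b.2)%N
    (zip (label_bits p.1) (label_bits p.2)) ==
  map (fun b : bool * bool => b.1 + b.2)%N
    (zip (label_bits q.1) (label_bits q.2)).

Definition label_lt (x y : label) : bool := (index x labels < index y labels)%N.

Definition relation : Type := ((label * label) * (label * label))%type.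

(** Identities x + y = z + w normalised under the obvious swaps; [label0] can occur only as x. The
    conditions on y keep its coefficient in x + y - z - w equal to 1, which supplies a pivot. *)
Definition relations : seq relation :=
  let pairs := [seq p <- [seq (x, y) | x <- labels, y <- labels] |
                 label_lt p.1 p.2] in
  [seq r <- [seq (p, q) | p <- pairs, q <- pairs] |
    [&& balanced r.1 r.2, label_lt r.1.1 r.2.1, r.1.2 != label0,
        r.1.2 != r.2.1 & r.1.2 != r.2.2]].

Lemma relationsP r : r \in relations ->
  [/\ balanced r.1 r.2, label_lt r.1.1 r.1.2 &
      [/\ r.1.2 != label0, r.1.2 != r.2.1 & r.1.2 != r.2.2]].
Proof.
rewrite mem_filter => /andP[/and5P[bal _ y0 yz yw] /allpairsP[[p q] [pP _ rE]]].
by move: pP; rewrite mem_filter {}rE in bal y0 yz yw * => /andP[xy _].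
Qed.

Definition rel_labels (r : relation) : seq label := [:: r.1.1; r.1.2; r.2.1; r.2.2].

Definition ordered_pair (x y : label) : label * label :=
  if label_lt x y then (x, y) else (y, x).

Definition literal : Type := ((label * label) * bool)%type.

(** If f of these literals fail, x + y - z - w has norm 2(2 - f), so positivity says that at most
    one fails. *)
Definition rel_literals (r : relation) : seq literal :=
  let: ((x, y), (z, w)) := r in
  [:: (ordered_pair x y, true); (ordered_pair z w, true);
      (ordered_pair x z, false); (ordered_pair x w, false);
      (ordered_pair y z, false); (ordered_pair y w, false)].

Definition push_bit (b : bool) (p : BinNums.positive) : BinNums.positive :=
  if b then BinNums.xI p else BinNums.xO p.

Definition pair_key (p : label * label) : BinNums.positive :=
  foldr push_bit BinNums.xH (label_bits p.1 ++ label_bits p.2).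

Definition facts := PositiveMap.t bool.

Definition refuted (M : facts) (l : literal) : bool :=
  if PositiveMap.find (pair_key l.1) M is Some b then b != l.2 else false.

(** One failure is tolerated: once a literal is refuted all the others are forced, and two refuted
    literals are a contradiction. *)
Definition unit_step (ls : seq literal) (M : facts) : option facts :=
  match count (refuted M) ls with
  | 0 => Some M
  | 1 => Some (foldr (fun l M' => if refuted M l then M'
                                  else PositiveMap.add (pair_key l.1) l.2 M') M ls)
  | _ => None
  end.

Fixpoint unit_pass (lss : seq (seq literal)) (M : facts) : option facts :=
  if lss is ls :: lss' then
    if unit_step ls M is Some M' then unit_pass lss' M' else None
  else Some M.

Fixpoint unit_refute (fuel : nat) (lss : seq (seq literal)) (M : facts) : bool :=
  if fuel is fuel'.+1 then
    if unit_pass lss M is Some M' then unit_refute fuel' lss M' else true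
  else false.

Definition initial_facts : facts :=
  foldr (fun x => PositiveMap.add (pair_key (ordered_pair label0 x)) false)
    (PositiveMap.empty bool) labels.

Definition crel : Type := (seq label * seq literal)%type.

(** Branches over all sets of at most [budget] missing labels; dropping a label deletes the
    relations that mention it, and each leaf runs unit propagation. *)
Fixpoint refute_missing (todo : seq label) (budget : nat) (rs : seq crel) : bool :=
  if todo is x :: todo' then
    refute_missing todo' budget rs &&
    (if budget is budget'.+1 then
       refute_missing todo' budget' [seq r <- rs | x \notin r.1]
     else true)
  else unit_refute 5 [seq r.2 | r <- rs] initial_facts.

Definition nonzero_labels := [seq x <- labels | x != label0].

Definition compiled := [seq (rel_labels r, rel_literals r) | r <- relations].

(** There are 1 + 15 + 105 + 455 = 576 leaves, each refuted within five passes. *)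
Lemma refute_missing3 : refute_missing nonzero_labels 3 compiled.
Proof. by vm_compute. Qed.

Lemma push_bit_inj b b' p p' : push_bit b p = push_bit b' p' -> b = b' /\ p = p'.
Proof. by case: b b' => -[] // [->]. Qed.

Lemma pair_key_inj : injective pair_key.
Proof.
move=> [[[[a b] c] d] [[[a1 b1] c1] d1]] [[[[a' b'] c'] d'] [[[a1' b1'] c1'] d1']].
rewrite /pair_key /=.
by do 8!(move=> /push_bit_inj[->]).
Qed.

Section Soundness.
Variable a : rel label.
Hypothesis aC : symmetric a.

Let holds (l : literal) : bool := a l.1.1 l.1.2 == l.2.

Definition sound_facts (M : facts) :=
  forall p b, PositiveMap.find (pair_key p) M = Some b -> holds (p, b).

Let refuted_holds M l : sound_facts M -> refuted M l -> ~~ holds l.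
Proof.
case: l => p b sM; rewrite /refuted.
case: PositiveMap.find (sM p) => // b' /(_ b' erefl).
by rewrite /holds /= => /eqP <-.
Qed.

Let sound_add M l : sound_facts M -> holds l ->
  sound_facts (PositiveMap.add (pair_key l.1) l.2 M).
Proof.
move=> sM lh p b; case: (eqVneq p l.1) => [->|pl].
  by rewrite PositiveMap.gss => -[<-]; case: l lh.
rewrite PositiveMap.gso; first exact: sM.
by move=> /pair_key_inj E; rewrite E eqxx in pl.
Qed.

Let at_most_one_fails (ls : seq literal) := (count (predC holds) ls <= 1)%N.

(** Refuted literals do fail, so at most one is refuted; when one is, it is the only failing literal
    and the facts added for the others are true. *)
Lemma unit_step_sound ls M : at_most_one_fails ls -> sound_facts M ->
  exists2 M', unit_step ls M = Some M' & sound_facts M'.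
Proof.
move=> ls1 sM; rewrite /unit_step.
have sub : subpred (refuted M) (predC holds) by move=> l; apply: refuted_holds.
have := leq_trans (sub_count sub ls) ls1.
case E: (count (refuted M) ls) => [|[|//]] _; first by exists M.
have nref l : l \in ls -> ~~ refuted M l -> holds l.
  move=> lls nl; apply: contraLR ls1 => lh; rewrite -ltnNge.
  pose B l' := ~~ refuted M l' && ~~ holds l'.
  have B0 : (0 < count B ls)%N.
    by rewrite -has_count; apply/hasP; exists l => //; rewrite /B nl.
  have I0 : count (predI (refuted M) B) ls = 0%N.
    by rewrite (@eq_count _ _ pred0) ?count_pred0 // => l' /=; rewrite /B andbA andbN.
  have U2 : (count (predU (refuted M) B) ls <= count (predC holds) ls)%N.
    by apply: sub_count => l' /orP[/(sub _)|/andP[]].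
  have := count_predUI (refuted M) B ls.
  by rewrite I0 E; move: U2 B0; lia.
eexists; first by reflexivity.
elim: ls nref {ls1 E} => [|l ls IH] nref //=.
have {}IH := IH (fun l' l'ls => nref l' (@mem_behead _ (l :: ls) _ l'ls)).
by case: ifPn => // nl; apply: sound_add => //; apply: nref nl; rewrite mem_head.
Qed.

Lemma unit_refute_sound fuel lss M : {in lss, forall ls, at_most_one_fails ls} ->
  sound_facts M -> unit_refute fuel lss M = false.
Proof.
move=> lss1; elim: fuel M => [//|fuel IH] M sM /=.
suff [M' -> sM'] : exists2 M', unit_pass lss M = Some M' & sound_facts M' by exact: IH.
elim: lss lss1 M sM {IH} => [|ls lss IH] lss1 M sM /=; first by exists M.
have [M' -> sM'] := unit_step_sound (lss1 ls (mem_head _ _)) sM.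
by apply: IH sM' => l lP; apply: lss1; rewrite inE lP orbT.
Qed.

Hypothesis a0 : forall x, a label0 x = false.

Lemma initial_facts_sound : sound_facts initial_facts.
Proof.
rewrite /initial_facts; elim: labels => [|x xs IH] /=.
  by move=> p b; rewrite PositiveMap.gempty.
apply: (sound_add (l := (ordered_pair label0 x, false))) => //.
by rewrite /holds /ordered_pair; case: ifP => _; rewrite /= ?a0 // aC a0.
Qed.

Variable present : pred label.

(** The actual set of missing labels selects one branch, where propagation cannot succeed.
    Invariant: the surviving relations mention only labels that are present or still to be
    decided. *)
Lemma refute_missing_sound todo budget rs :
  (count (predC present) todo <= budget)%N ->
  {in rs, forall r, {subset r.1 <= predU present (mem todo)} /\
     (all present r.1 -> at_most_one_fails r.2)} ->
  refute_missing todo budget rs = false.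
Proof.
elim: todo budget rs => [|x todo IH] budget rs.
  move=> _ rsP; apply: unit_refute_sound; last exact: initial_facts_sound.
  move=> _ /mapP[r rrs ->]; have [sub] := rsP r rrs; apply.
  by apply/allP => y /sub; rewrite !inE orbF.
rewrite /=; have [px|npx] /= := boolP (present x).
  rewrite add0n => cnt rsP; rewrite IH // => r rrs; have [sub H] := rsP r rrs.
  split=> // y /sub; rewrite !inE => /or3P[->|/eqP->|->] //; rewrite ?orbT //.
  by rewrite [X in X || _]px.
case: budget => [//|budget]; rewrite add1n ltnS => cnt rsP.
rewrite [X in _ && X]IH ?andbF // => r; rewrite mem_filter => /andP[xr rrs].
have [sub H] := rsP r rrs; split=> // y yr.
have := sub y yr; rewrite !inE => /or3P[->|/eqP yx|->] //; last by rewrite orbT.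
by rewrite -yx yr in xr.
Qed.

End Soundness.

Lemma mem_nonzero_labels l : (l \in nonzero_labels) = (l != label0).
Proof. by rewrite mem_filter; case: l => [[[[] []] []] []]. Qed.

Lemma labelling_missing (a : rel label) (present : pred label) :
  symmetric a -> (forall x, a label0 x = false) -> present label0 ->
  {in relations, forall r, all present (rel_labels r) ->
     (count (fun l => a l.1.1 l.1.2 != l.2) (rel_literals r) <= 1)%N} ->
  (3 < count (predC present) nonzero_labels)%N.
Proof.
move=> aC a0 p0 H; rewrite ltnNge; apply/negP => cnt.
suff: refute_missing nonzero_labels 3 compiled = false by rewrite refute_missing3.
apply: (refute_missing_sound aC a0 cnt) => _ /mapP[r rr ->]; split=> [x|].
  move=> _; apply/orP; have [->|x0] := eqVneq x label0; [by left | right].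
  by change (x \in nonzero_labels); rewrite mem_nonzero_labels.
exact: H.
Qed.

(** * Graphs with four independent vertices *)

Section IndependentQuadruple.
Variables (m : nat) (e : rel 'I_m).
Hypothesis e_simple : simple_graph e.
Hypothesis few : ~ at_least_nonpos_eigs 5 (adj_mx e).
Variable s : 'I_4 -> 'I_m.
Hypothesis s_inj : injective s.
Hypothesis s_indep : forall i j, ~~ e (s i) (s j).

Let eC x y : e x y = e y x. Proof. by case: e_simple. Qed.
Let eI x : e x x = false. Proof. by case: e_simple => _ /(_ x)/negbTE. Qed.

Let outside := ~: [set s i | i in 'I_4].

Lemma quadruple_pos z x : x \in outside ->
  (forall i, bform e (unitv (s i)) z = 0) -> z 0 x != 0 -> 0 < bform e z z.
Proof.
move=> xO sz zx; pose f i := (unitv (s i), s i).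
have ss i j : bform e (unitv (s i)) (unitv (s j)) = 0.
  by rewrite bform_unitv (negbTE (s_indep i j)).
have sa i j : unitv (s i) 0 (s j) = (i == j)%:R by rewrite unitvE (inj_eq s_inj).
have so i : unitv (s i) 0 x = 0.
  move: xO; rewrite unitvE in_setC; case: eqP => // <-.
  by rewrite imset_f.
apply: (bform_pos e_simple few (ps := [:: f 0; f 1; f 2; f 3])) zx => //.
- by rewrite /orthogonal_frame /= !ss !sa.
- by rewrite /= !ss !lexx.
- by rewrite /= !sz !so.
Qed.

Definition lab (v : 'I_m) : label := (e v (s 0), e v (s 1), e v (s 2), e v (s 3)).

Let e_outside i v : bform e (unitv (s i)) (unitv v) = (nth false (label_bits (lab v)) i)%:R.
Proof.
rewrite bform_unitv eC.
by case: i => -[|[|[|[|]]]] // ?; congr ((e v (s _))%:R); apply: val_inj.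
Qed.

Let lab_neq0 v : v \in outside -> lab v != label0.
Proof.
move=> vO; apply/eqP => v0; have: 0 < bform e (unitv v) (unitv v).
  apply: (quadruple_pos vO) => [i|]; last by rewrite unitvE eqxx.
  by rewrite e_outside v0; case: i => -[|[|[|[|]]]].
by rewrite bform_unitv eI.
Qed.

(** The difference of two vertices with equal labels is orthogonal to the quadruple and has norm 0
    or -2. *)
Let lab_inj : {in outside &, injective lab}.
Proof.
move=> u v uO vO uv; apply/eqP/negPn/negP => neq_uv.
have: 0 < bform e (unitv u - unitv v) (unitv u - unitv v).
  apply: (quadruple_pos uO) => [i|]; first by rewrite !bformE !e_outside uv subrr.
  by rewrite !coordE !unitvE eqxx (eq_sym v) (negbTE neq_uv).
by rewrite !bformE !bform_unitv !eI (eC v u); case: (e u v).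
Qed.

Let vertex_of (l : label) : option 'I_m := [pick v in outside | lab v == l].

Let vertex_ofP l v : vertex_of l = Some v -> v \in outside /\ lab v = l.
Proof. by rewrite /vertex_of; case: pickP => // w /andP[wO /eqP wl] [<-]. Qed.

Let vertex_of0 : vertex_of label0 = None.
Proof.
by case E: (vertex_of label0) => [v|//]; case: (vertex_ofP E) => /lab_neq0 /eqP.
Qed.

(* The label [label0] is not carried by any vertex; treating it as present with
   the zero vector turns x + y = z into an instance of x + y = z + w. *)
Let vec (l : label) : 'rV[int]_m := if vertex_of l is Some v then unitv v else 0.

Let adj (l l' : label) : bool :=
  if vertex_of l is Some u then
    if vertex_of l' is Some v then e u v else false
  else false.

Let present (l : label) : bool := (l == label0) || vertex_of l.

Let adjC : symmetric adj.
Proof.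
by move=> l l'; rewrite /adj; case: (vertex_of l) => [u|]; case: (vertex_of l').
Qed.

Let adjI l : adj l l = false.
Proof. by rewrite /adj; case: vertex_of. Qed.

Let bform_vec l l' : bform e (vec l) (vec l') = (adj l l')%:R.
Proof.
rewrite /vec /adj; case: vertex_of => [u|]; last by rewrite bform0l.
by case: vertex_of => [v|]; rewrite ?bform0r // bform_unitv.
Qed.

Let bform_s_vec i l : present l ->
  bform e (unitv (s i)) (vec l) = (nth false (label_bits l) i)%:R.
Proof.
rewrite /present /vec; case: eqP => [-> _|_] /=.
  by rewrite vertex_of0 bform0r; case: i => -[|[|[|[|]]]].
case E: (vertex_of l) => [v|//] _; rewrite e_outside.
by case: (vertex_ofP E) => _ ->.
Qed.

Let vec_at l l' v : vertex_of l = Some v -> vec l' 0 v = (l' == l)%:R.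
Proof.
move=> E; have [vO vl] := vertex_ofP E; rewrite /vec.
case E': (vertex_of l') => [v'|].
  have [v'O v'l'] := vertex_ofP E'.
  by rewrite unitvE -vl -v'l' (inj_in_eq lab_inj).
by rewrite mxE; case: eqP => // ll'; rewrite -ll' E' in E.
Qed.

Let adj_ordered_pair x y : adj (ordered_pair x y).1 (ordered_pair x y).2 = adj x y.
Proof. by rewrite /ordered_pair; case: ifP => //= _; rewrite adjC. Qed.

(** Balance makes x + y - z - w orthogonal to the quadruple, and its coordinate at the vertex
    labelled y is 1; [quadruple_pos] then makes its norm positive. *)
Let relation_holds r : r \in relations -> all present (rel_labels r) ->
  (count (fun l => adj l.1.1 l.1.2 != l.2) (rel_literals r) <= 1)%N.
Proof.
case: r => [[x y] [z w]] /relationsP[bal xy [y0 yz yw]].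
have {}xy : x != y by apply: contraTneq xy => /= ->; rewrite /label_lt ltnn.
case/and5P=> px py pz pw _.
case Ey: (vertex_of y) => [v|]; last by rewrite /present (negbTE y0) Ey in py.
have [vO _] := vertex_ofP Ey.
have : 0 < bform e (vec x + vec y - vec z - vec w) (vec x + vec y - vec z - vec w).
  apply: (quadruple_pos vO) => [i|]; last first.
    by rewrite !coordE !(vec_at _ Ey) (negbTE xy) eqxx ![_ == y]eq_sym (negbTE yz) (negbTE yw).
  rewrite !bformE !bform_s_vec //.
  move: bal; rewrite /balanced /=.
  case: x y z w {y0 yz yw xy px py pz pw Ey} => [[[x0 x1] x2] x3] [[[y0 y1] y2] y3]
    [[[z0 z1] z2] z3] [[[w0 w1] w2] w3] /= /eqP[b0 b1 b2 b3].
  by case: i => -[|[|[|[|]]]] //= _; rewrite -addrA -opprD -!natrD ?b0 ?b1 ?b2 ?b3 subrr.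
rewrite !bformE !bform_vec !adjI (adjC y x) (adjC z x) (adjC w x) (adjC z y)
  (adjC w y) (adjC w z) /= !adj_ordered_pair.
by case: (adj x y); case: (adj z w); case: (adj x z); case: (adj x w);
  case: (adj y z); case: (adj y w).
Qed.

Lemma independent_quadruple_bound : (m <= 15)%N.
Proof.
have := cardsC [set s i | i in 'I_4]; rewrite card_imset // !card_ord => <-.
rewrite -/outside (leq_add2l 4 _ 11) -(card_in_imset lab_inj).
have adj0 x : adj label0 x = false by rewrite /adj vertex_of0.
have pr0 : present label0 by rewrite /present eqxx.
have := labelling_missing adjC adj0 pr0 relation_holds.
have sz : size nonzero_labels = 15%N by [].
have := count_predC present nonzero_labels; rewrite sz -size_filter => cnt miss.
apply: leq_trans (_ : size [seq l <- nonzero_labels | present l] <= _)%N; last first.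
  by rewrite -(leq_add2r (count (predC present) nonzero_labels)) cnt (leq_add2l 11 4).
apply: leq_trans (card_size _); apply/subset_leq_card/subsetP => _ /imsetP[v vO ->].
rewrite mem_filter mem_nonzero_labels lab_neq0 // andbT /present /vertex_of.
by case: pickP => [w _|/(_ v)]; rewrite ?orbT // vO eqxx.
Qed.

End IndependentQuadruple.

(** * Assembling the bound, and the extremal graph *)

Section Ramsey.
Variables (m : nat) (e : rel 'I_m).
Hypothesis e_simple : simple_graph e.

Let eC x y : e x y = e y x. Proof. by case: e_simple. Qed.
Let eI x : e x x = false. Proof. by case: e_simple => _ /(_ x)/negbTE. Qed.

Lemma subset_of_card (A : {set 'I_m}) k : (k <= #|A|)%N ->
  exists2 B : {set 'I_m}, B \subset A & #|B| = k.
Proof.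
case/card_geqP=> t [ut st tA]; exists [set x in t].
  by apply/subsetP=> x; rewrite inE => /tA.
by rewrite cardsE -st; apply/card_uniqP.
Qed.

(** The non-neighbours of a vertex v form a clique. If there are at most [k] of them, at least
    ['C(k.+1, 2)] neighbours of v remain for the induction, and v is added to the clique found
    there. A K5 thus needs ['C(6, 2)], that is 15, vertices. *)
Lemma clique_of_no_independent_triple (T : {set 'I_m}) k :
  (forall A : {set 'I_m}, {in A &, forall x y, ~~ e x y} -> (#|A| <= 2)%N) ->
  ('C(k.+1, 2) <= #|T|)%N ->
  exists K : {set 'I_m}, [/\ K \subset T, #|K| = k &
    {in K &, forall x y, x != y -> e x y}].
Proof.
move=> alpha2; elim: k T => [|k IH] T.
  by exists set0; split; rewrite ?sub0set ?cards0 // => x y; rewrite in_set0.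
rewrite binS bin1 => cT; have /card_gt0P[v vT] : (0 < #|T|)%N by lia.
pose N := [set x in T | e v x]; pose M := [set x in T :\ v | ~~ e v x].
have cNM : #|T| = (#|N| + #|M|).+1.
  rewrite (cardsD1 v) vT add1n; congr _.+1.
  rewrite -(cardsID [set x | e v x] (T :\ v)); congr (_ + _)%N; apply: eq_card => x.
    by rewrite !in_set in_set1; have [->|_] := eqVneq x v; rewrite ?eI ?andbF.
  by rewrite !in_set andbC.
have [kM|kM] := leqP k.+1 #|M|.
  have [K KM cK] := subset_of_card kM; exists K; split=> //.
    by apply: subset_trans KM _; apply/subsetP=> x; rewrite !in_set => /andP[/andP[_ ->]].
  move=> x y /(subsetP KM) + /(subsetP KM); rewrite !inE.
  move=> /andP[/andP[xv _] vx] /andP[/andP[yv _] vy] xy.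
  apply: contraT => exy; have : (#|v |: [set x; y]| <= 2)%N.
    apply: alpha2 => a b; rewrite !inE.
    by move=> /or3P[]/eqP-> /or3P[]/eqP->; rewrite ?eI ?vx ?vy // eC ?vx ?vy.
  rewrite cardsU1 !inE cards2 xy.
  by rewrite ![v == _]eq_sym (negbTE xv) (negbTE yv).
have [|K [KN cK Kcl]] := IH N; first lia.
have vK : v \notin K by apply/negP => /(subsetP KN); rewrite in_set eI andbF.
exists (v |: K); split; last 1 first.
- move=> x y /setU1P[->|xK] /setU1P[->|yK]; rewrite ?eqxx // => xy.
  + by move/(subsetP KN): yK; rewrite in_set => /andP[].
  + by move/(subsetP KN): xK; rewrite in_set eC => /andP[].
  + exact: Kcl.
- apply/subsetP=> x /setU1P[->//|/(subsetP KN)]; rewrite in_set.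
  by case/andP.
- by rewrite cardsU1 vK cK.
Qed.

End Ramsey.

Section UpperBound.
Variables (m : nat) (e : rel 'I_m).
Hypothesis e_simple : simple_graph e.

Lemma few_nonpos_order : ~ at_least_nonpos_eigs 5 (adj_mx e) -> (m <= 15)%N.
Proof.
move=> few; pose indep (A : {set 'I_m}) := [forall x in A, forall y in A, ~~ e x y].
have indepP (A : {set 'I_m}) : reflect {in A &, forall x y, ~~ e x y} (indep A).
  apply: (iffP forall_inP) => [H x y xA yA|H x xA].
    by have /forall_inP := H x xA; apply.
  by apply/forall_inP => y; apply: H.
have tup n (A : {set 'I_m}) : #|A| = n -> exists2 s : 'I_n -> 'I_m,
    injective s & forall i, s i \in A.
  move=> cA; exists (fun i => enum_val (cast_ord (esym cA) i)).
    by move=> i j /enum_val_inj/cast_ord_inj.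
  by move=> i; apply: enum_valP.
have large n : ~~ [exists A : {set 'I_m}, indep A && (#|A| == n.+1)] ->
    forall A : {set 'I_m}, {in A &, forall x y, ~~ e x y} -> (#|A| <= n)%N.
  move=> no A Aind; rewrite leqNgt; apply: contra no => /subset_of_card[B BA cB].
  apply/existsP; exists B; rewrite cB eqxx andbT; apply/indepP => x y xB yB.
  by apply: Aind; exact: (subsetP BA).
have [/existsP[A /andP[/indepP iA /eqP cA]]|/large a3] :=
  boolP [exists A : {set 'I_m}, indep A && (#|A| == 4)].
  have [s s_inj sA] := tup _ _ cA.
  by apply: (independent_quadruple_bound e_simple few s_inj) => i j; apply: iA.
have [/existsP[A /andP[/indepP iA /eqP cA]]|/large a2] :=
  boolP [exists A : {set 'I_m}, indep A && (#|A| == 3)].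
  have [s s_inj sA] := tup _ _ cA.
  by apply: (independent_triple_bound e_simple few a3 s_inj) => i j; apply: iA.
rewrite leqNgt; apply/negP => m16.
have [|K [_ cK Kcl]] := @clique_of_no_independent_triple _ _ e_simple [set: 'I_m] 5 a2.
  by rewrite cardsT card_ord (leq_trans _ m16).
have [k k_inj kK] := tup _ _ cK.
suff : (m <= 15)%N by rewrite leqNgt m16.
apply: (clique_bound e_simple few (k := k)) => i j.
have [->|ij] := eqVneq i j; first by case: e_simple => _ /(_ (k j))/negbTE.
by apply: Kcl; rewrite ?kK // inj_eq.
Qed.

End UpperBound.

(* The vertices 0, ..., 4 span the K5; the vertices 5, ..., 14 stand for the pairs
   of them and carry the Petersen graph. *)
Definition extremal_pairs : seq (nat * nat) :=
  [:: (0, 1); (0, 2); (0, 3); (0, 4); (1, 2); (1, 3); (1, 4); (2, 3); (2, 4); (3, 4)]%N.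

Definition extremal_pair (x : nat) : nat * nat := nth (0, 1)%N extremal_pairs (x - 5).

Definition in_pair (x y : nat) : bool :=
  (x == (extremal_pair y).1) || (x == (extremal_pair y).2).

(** Two pairs are adjacent when disjoint, the Kneser description of the Petersen graph. *)
Definition extremal_adj (x y : nat) : bool :=
  if (x < 5)%N then if (y < 5)%N then x != y else in_pair x y
  else if (y < 5)%N then in_pair y x
  else ~~ in_pair (extremal_pair x).1 y && ~~ in_pair (extremal_pair x).2 y.

Definition extremal_graph : rel 'I_15 := fun x y => extremal_adj x y.

Lemma extremal_simple : simple_graph extremal_graph.
Proof.
have H : all (fun x => all (fun y => extremal_adj x y == extremal_adj y x) (iota 0 15) &&
                       ~~ extremal_adj x x) (iota 0 15) by vm_compute.
have Hx (x : 'I_15) := allP H x (etrans (mem_iota 0 15 x) (ltn_ord x)).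
split=> [x y|x]; last by case/andP: (Hx x).
case/andP: (Hx x) => /allP/(_ y) + _.
by rewrite mem_iota ltn_ord => /(_ isT)/eqP.
Qed.

(* The clique's all-ones vector, and twice the projections of the unit vectors at
   the pairs off the span of the clique. *)
Definition extremal_vec (k i : nat) : int :=
  if k is 0 then (i < 5)%N%:R
  else if (i < 5)%N then 2 * (in_pair i (k + 4))%:R - 1
  else 2 * (i == k + 4)%N%:R.

(** Pivot coordinates; the cap at 14 keeps every value below 15, so that [inord] preserves it. *)
Definition extremal_index (k : nat) : nat := if k is 0 then 0 else minn (k + 4) 14.

(** Explicit folds, which unlike [bform] can be evaluated by [vm_compute]. *)
Definition extremal_form (k l : nat) : int :=
  foldr (fun j a => foldr (fun i b => extremal_vec k i * (extremal_adj i j)%:R + b) 0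
                      (iota 0 15) * extremal_vec l j + a) 0 (iota 0 15).

Lemma extremal_formE k l :
  bform extremal_graph (\row_i extremal_vec k i) (\row_i extremal_vec l i) =
  extremal_form k l.
Proof.
have sumE (F : nat -> int) : \sum_(i < 15) F i = foldr (fun i a => F i + a) 0 (iota 0 15).
  by rewrite -(big_mkord xpredT) unlock.
rewrite /bform mxE /extremal_form -[RHS]sumE; apply: eq_bigr => j _.
rewrite !mxE -[in RHS]sumE; congr (_ * _).
by apply: eq_bigr => i _; rewrite !mxE.
Qed.

(** Two distinct pairs are either disjoint and adjacent, or share one vertex and are not adjacent;
    in both cases their Schur entry 4a + 4c - 4 (a the adjacency, c the number of shared vertices)
    is 0. This gives eleven orthogonal vectors of positive norm, leaving 15 - 11 = 4. *)
Lemma extremal_few k : at_least_nonpos_eigs k (adj_mx extremal_graph) -> (k <= 4)%N.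
Proof.
pose ps := [seq (\row_(i < 15) extremal_vec k i, inord (extremal_index k) : 'I_15) |
             k <- iota 0 11].
have idx l : (inord (extremal_index l) : 'I_15) = extremal_index l :> nat.
  by rewrite inordK //; case: l => // l; rewrite ltnS geq_minr.
have fr : orthogonal_frame extremal_graph ps.
  rewrite /orthogonal_frame all_map pairwise_map; apply/andP; split.
    have : all (fun k => extremal_vec k (extremal_index k) != 0) (iota 0 11) by vm_compute.
    by apply: sub_all => l; rewrite /= mxE idx.
  have : pairwise (fun k l => (extremal_form k l == 0) &&
                    (extremal_vec k (extremal_index l) == 0)) (iota 0 11) by vm_compute.
  by apply: sub_pairwise => l l'; rewrite /= extremal_formE mxE idx.
have pos : all (fun p => 0 < bform extremal_graph p.1 p.1) ps.
  have : all (fun k => 0 < extremal_form k k) (iota 0 11) by vm_compute.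
  by rewrite all_map; apply: sub_all => l; rewrite /= extremal_formE.
move/(pos_frame_eigs extremal_simple fr pos).
by rewrite size_map size_iota (leq_add2r 11 _ 4).
Qed.

Theorem mainTheorem10 : NPO_is 5 16.
Proof.
split=> [m e m16 e_simple|n n_bound].
  apply/(at_least_nonposP e_simple)/negPn/negP => few.
  suff : (m <= 15)%N by rewrite leqNgt m16.
  by apply: (few_nonpos_order e_simple) => /(at_least_nonposP e_simple); apply/negP.
rewrite leqNgt ltnS; apply/negP => n15.
by have /extremal_few := n_bound _ _ n15 extremal_simple.
Qed.
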